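(* Let $X$ be a first countable crowded compact space. Then $X$ is pin homogeneous.
   Context: All spaces are assumed to be Hausdorff. A space is crowded if it has no isolated points. Points $a,b$ in a compact space $X$ are pin equivalent (in $X$) if there exist a compact space $Y$, a continuous surjection $f\colon Y\to X$, and a homeomorphism $g\colon Y\to Y$ such that $g(f^{-1}\{a\})=f^{-1}\{b\}$. A compact space is pin homogeneous if every two of its points are pin equivalent. *)

(* Defs.v *)
From HB Require Import structures.
From mathcomp Require Import all_boot all_order all_algebra.
From mathcomp Require Import all_classical all_reals all_analysis.

Set Implicit Arguments.
Unset Strict Implicit.
Unset Printing Implicit Defensive.

Local Open Scope classical_set_scope.

(* [compact] does not include the Hausdorff axiom in MathComp-Analysis. *)
Definition compact_hausdorff (X : topologicalType) : Prop :=
  hausdorff_space X /\ compact [set: X].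

(* The members of [B] are neighborhoods, not necessarily open. *)
Definition first_countable (X : topologicalType) : Prop :=
  forall x : X, exists2 B : set (set X),
    countable B & B `<=` nbhs x /\ filter_from B id --> x.

Definition crowded (X : topologicalType) : Prop :=
  isolated [set: X] = set0.

Definition homeomorphism (X Y : topologicalType) (g : X -> Y) : Prop :=
  continuous g /\
  exists h : Y -> X, [/\ cancel g h, cancel h g & continuous h].

Definition pin_equivalent (X : topologicalType) (a b : X) : Prop :=
  exists (Y : topologicalType) (f : Y -> X) (g : Y -> Y),
    [/\ compact_hausdorff Y,
        continuous f /\ set_surj [set: Y] [set: X] f,
        homeomorphism g
      & g @` (f @^-1` [set a]) = f @^-1` [set b]].

Definition pin_homogeneous (X : topologicalType) : Prop :=
  forall a b : X, pin_equivalent a b.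

(* Main.v *)
Require Import Defs.
From mathcomp Require Import all_boot all_order all_algebra.
From mathcomp Require Import all_classical all_reals all_analysis.

(** If [a] and [b] are distinct, pick closed sets [A], [B] covering [X], with
    [a] outside [B] and [b] outside [A], and strictly decreasing open
    neighborhoods [O n] of [a] and [P n] of [b] whose closures intersect in
    [{a}] and [{b}].  The relation "[x] in [A] is as deep in [O] as [y] in [B]
    is deep in [P]" is, once closures are inserted, a closed subset [L] of
    [X * X] that projects onto [A] and [B] and matches [a] with [b] only; the
    levels of [O] and [P] are nonempty because [X] is crowded.  Then [Y] is the
    union of [L] and its transpose, [f] the first projection, [g] the swap. *)

Set Implicit Arguments.
Unset Strict Implicit.
Unset Printing Implicit Defensive.

Local Open Scope classical_set_scope.

Lemma first_countable_seq (X : topologicalType) (x : X) :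
  first_countable X -> exists W : nat -> set X,
    (forall n, nbhs x (W n)) /\ (forall U, nbhs x U -> exists n, W n `<=` U).
Proof.
move=> /(_ x)[B /countable_injP[f finj] [Bx xB]].
(* As [f] is injective on [B], this is the member of [B] numbered [n], or the whole space if [n]
   numbers no member. *)
exists (fun n => [set y | forall V, B V -> f V = n -> V y]); split.
- move=> n; have [[V [BV fV]]|noV] := pselect (exists V, B V /\ f V = n).
    apply: filterS (Bx _ BV) => y Vy U BU fU.
    by rewrite (finj U V) ?inE ?fU ?fV.
  by apply: nearW => y V BV fV; exfalso; apply: noV; exists V.
- move=> U /xB[V BV VU]; exists (f V) => y /(_ V BV erefl); exact: VU.
Qed.

Lemma crowded_nbhs (X : topologicalType) (x : X) (U : set X) :
  crowded X -> nbhs x U -> exists2 y, U y & y <> x.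
Proof.
move=> hcr xU; apply: contrapT => noy.
suff : isolated [set: X] x by rewrite hcr.
split; first by rewrite inE.
exists U => //; rewrite setIT; apply/seteqP; split => [y Uy|y ->] /=.
  by apply: contrapT => yx; apply: noy; exists y.
exact: nbhs_singleton.
Qed.

Lemma hausdorff_sep (X : topologicalType) (x y : X) : hausdorff_space X ->
  x <> y -> exists U V, [/\ open_nbhs x U, open_nbhs y V & U `<=` ~` V].
Proof.
rewrite open_hausdorff => hX /eqP/hX[[U V]] /= [] /set_mem Ux /set_mem Vy.
by move=> [oU oV /eqP/disjoints_subset UV]; exists U, V.
Qed.

(** Strictness supplies partners of every depth; the closures in the last clause match those in
    [level_rel]. Only successor indices occur there, which leaves [O 0] free to be prescribed. *)
Definition shrinks_to (X : topologicalType) (O : nat -> set X) (a : X) : Prop :=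
  [/\ forall n, open_nbhs a (O n),
      forall n, O n.+1 `<=` O n,
      forall n, O n `\` O n.+1 !=set0
    & forall x, (forall n, closure (O n.+1) x) -> x = a].

Lemma exists_shrinks_to (X : topologicalType) (a : X) (G : set X) :
  hausdorff_space X -> first_countable X -> crowded X -> open_nbhs a G ->
  exists O, O 0 = G /\ shrinks_to O a.
Proof.
move=> hX hfc hcr aG.
have [W [Wa WU]] := first_countable_seq a hfc.
have step (p : nat * set X) : exists S, open_nbhs a p.2 ->
    [/\ open_nbhs a S, S `<=` p.2, S `<=` W p.1 & p.2 `\` S !=set0].
  case: p => n S /=.
  have [aS|] := pselect (open_nbhs a S); last by move=> naS; exists S.
  have [z Sz za] := crowded_nbhs hcr (open_nbhs_nbhs aS).
  have [U [V [aU zV UV]]] := hausdorff_sep hX (nesym za).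
  (* Cutting by [U] discards [z], which makes the step strict; cutting by the interior of [W n]
     forces convergence to [a]. *)
  exists (S `&` U `&` (W n)°) => _; split.
  - apply: open_nbhsI; first exact: open_nbhsI.
    by split; [exact: open_interior|exact: Wa].
  - by move=> ? [[]].
  - by move=> ? [_ /interior_subset].
  - by exists z; split => // -[[_ /UV]] /(_ zV.2).
have [F FP] := choice step.
pose O := fix O n := if n is m.+1 then F (m, O m) else G.
have Oa n : open_nbhs a (O n) by elim: n => //= n /(FP (n, _))[].
exists O; split => //; split => //.
- by move=> n; have [] := FP (n, O n) (Oa n).
- by move=> n; have [] := FP (n, O n) (Oa n).
(* If [x] differs from [a], some [O n.+1] lies in [W n] and hence in [U], so it misses the
   neighborhood [V] of [x]. *)
- move=> x Ox; apply: contrapT => /nesym/(hausdorff_sep hX)[U [V [aU xV UV]]].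
  have [n WnU] := WU _ (open_nbhs_nbhs aU).
  have [y [Oy Vy]] := Ox n _ (open_nbhs_nbhs xV).
  have [_ _ FW _] := FP (n, O n) (Oa n).
  exact: UV (WnU _ (FW _ Oy)) Vy.
Qed.

Definition level_rel (X : topologicalType) (A B : set X) (O P : nat -> set X) :
    set (X * X) :=
  [set p | [/\ A p.1, B p.2
    & forall n, (O n.+1 p.1 -> closure (P n.+1) p.2) /\
                (P n.+1 p.2 -> closure (O n.+1) p.1)]].

Section LevelRel.
Context (X : topologicalType) (A B : set X) (O P : nat -> set X).
Implicit Types a b x y : X.

Lemma level_rel_swap x y :
  level_rel A B O P (x, y) -> level_rel B A P O (y, x).
Proof. by move=> [Ax By xy]; split => // n; have [] := xy n. Qed.

Lemma closed_level_rel : closed A -> closed B ->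
  (forall n, open (O n)) -> (forall n, open (P n)) ->
  closed (level_rel A B O P).
Proof.
move=> cA cB oO oP.
have /continuous_closedP cfst : continuous (@fst X X).
  by move=> p; exact: cvg_fst.
have /continuous_closedP csnd : continuous (@snd X X).
  by move=> p; exact: cvg_snd.
(* An implication from an open condition to a closed one defines a union of two closed sets. *)
suff -> : level_rel A B O P =
    (fst @^-1` A `&` snd @^-1` B) `&` \bigcap_n
      ((fst @^-1` (~` O n.+1) `|` snd @^-1` closure (P n.+1)) `&`
       (snd @^-1` (~` P n.+1) `|` fst @^-1` closure (O n.+1))).
  apply: closedI; first by apply: closedI; [exact: cfst|exact: csnd].
  apply: closed_bigI => n _; apply: closedI; apply: closedU.
  - apply: cfst; exact: open_closedC.
  - apply: csnd; exact: closed_closure.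
  - apply: csnd; exact: open_closedC.
  - apply: cfst; exact: closed_closure.
apply/seteqP; split=> -[x y] /=.
  move=> [Ax By xy]; split=> // n _; have [OP PO] := xy n; split.
    by have [Ox|] := pselect (O n.+1 x); [right; exact: OP|left].
  by have [Py|] := pselect (P n.+1 y); [right; exact: PO|left].
move=> [[Ax By] xy]; split=> //= n; have [/= xyO xyP] := xy n I.
by split=> [Ox|Py]; [case: xyO|case: xyP].
Qed.

Lemma level_rel_center a b y : shrinks_to O a -> shrinks_to P b ->
  level_rel A B O P (a, y) -> y = b.
Proof.
move=> [Oa _ _ _] [_ _ _ Pb] [_ _ ay]; apply: Pb => n.
by apply: (ay n).1; have [] := Oa n.+1.
Qed.

(** The point [a] is matched with [b]. For any other [x], take the least [n] with [x] outside
    [O n.+1]; every [y] in [P n] but not in [P n.+1] has the same depth. *)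
Lemma level_rel_total a b x : shrinks_to O a -> shrinks_to P b ->
  P 0 `<=` B -> A x -> exists y, level_rel A B O P (x, y).
Proof.
move=> [Oa Odec _ Oint] [Pb Pdec Pne _] PB Ax.
have mono (Q : nat -> set X) : (forall n, Q n.+1 `<=` Q n) ->
    forall m n, (m <= n)%N -> Q n `<=` Q m.
  by move=> Qdec m n /subnK <-; elim: (n - m)%N => // k IH z /Qdec/IH.
have [xa|xa] := pselect (x = a).
  exists b; split=> //=; first by apply: PB; have [] := Pb 0.
  move=> n; rewrite xa; split=> _; apply: subset_closure.
    by have [] := Pb n.+1.
  by have [] := Oa n.+1.
have exn : exists n, `[< ~ O n.+1 x >].
  apply: contrapT => none; apply: xa; apply: Oint => n.
  apply: subset_closure; apply: contrapT => nOx; apply: none.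
  by exists n; apply/asboolP.
case: (ex_minnP exn) => n /asboolP nOx nmin.
have [y [Py nPy]] := Pne n.
exists y; split=> //=; first exact/PB/(mono P Pdec 0 n).
(* Below [n] both conclusions hold, by minimality of [n] and by monotonicity of [P]; from [n] on
   both premises fail. *)
move=> m; case: (ltnP m n) => mn.
- split=> _; apply: subset_closure; first exact: (mono P Pdec _ n).
  apply: contrapT => nOmx; have /nmin : `[< ~ O m.+1 x >] by apply/asboolP.
  by rewrite leqNgt mn.
- by split=> [/(mono O Odec n.+1 m.+1 mn)|/(mono P Pdec n.+1 m.+1 mn)].
Qed.

End LevelRel.

Lemma compact_hausdorff_set_type (X : topologicalType) (S : set X) :
  compact_hausdorff X -> closed S -> compact_hausdorff (set_type S).
Proof.
move=> [hX cX] cS; have cval := @initial_continuous _ _ (@set_val X S).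
split.
  move=> p q pq; apply: val_inj; apply: hX => U V pU qV.
  by have [z [Uz Vz]] := pq _ _ (cval _ _ pU) (cval _ _ qV); exists (set_val z).
move=> F PF _.
have cptS : compact S by apply: (subclosed_compact cS cX).
(* The filter is pushed forward to [X]; its cluster point in [S] lifts back because open sets of the
   subspace are traces of open sets of [X]. *)
have [|x [Sx clx]] := cptS (set_val @ F).
  by apply: (@filterE _ F) => z; exact: set_valP.
exists (SigSub (mem_set Sx)); split=> // U V FU [_ [[W oW <-] Wx WV]].
have [|_ [[z Uz <-] Wz]] := clx (set_val @` U) W _ (open_nbhs_nbhs (conj oW Wx)).
  by apply: (@filterS _ F _ U) => // z Uz; exists z.
by exists z; split=> //; exact: WV.
Qed.

Lemma pin_equivalent_refl (X : topologicalType) (a : X) :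
  compact_hausdorff X -> pin_equivalent a a.
Proof.
have cid : continuous (@id X) by move=> x; exact: cvg_id.
move=> hX; exists X, id, id; split=> //.
- by split=> // x _; exists x.
- by split=> //; exists id.
- by rewrite image_id.
Qed.

(** On [S], the fibers of the first projection over [a] and [b] are the single points [(a, b)] and
    [(b, a)], which the swap exchanges. Symmetry keeps the swap inside [S], and totality makes the
    projection onto. *)
Lemma pin_equivalent_symmetric_rel (X : topologicalType) (S : set (X * X))
    (a b : X) :
  compact_hausdorff X -> closed S -> (forall x y, S (x, y) -> S (y, x)) ->
  (forall x, exists y, S (x, y)) ->
  (forall y, S (a, y) -> y = b) -> (forall y, S (b, y) -> y = a) ->
  pin_equivalent a b.
Proof.
move=> [hX cX] cS Ssym Stot Sa Sb.
have hXX : compact_hausdorff (X * X)%type.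
  split; last by rewrite -setXTT; exact: compact_setX.
  move=> [x1 x2] [y1 y2] xy; congr (_, _); apply: hX => U V xU yV.
    have [| |[z1 z2] [/= Uz Vz]] := xy (fst @^-1` U) (fst @^-1` V).
    + exact: cvg_fst xU.
    + exact: cvg_fst yV.
    by exists z1.
  have [| |[z1 z2] [/= Uz Vz]] := xy (snd @^-1` U) (snd @^-1` V).
  + exact: cvg_snd xU.
  + exact: cvg_snd yV.
  by exists z2.
have swapS (z : set_type S) : swap_pair (\val z) \in S.
  apply/mem_set/Ssym; rewrite -surjective_pairing; exact: set_valP.
pose g (z : set_type S) : set_type S := SigSub (swapS z).
have cval : continuous (\val : set_type S -> X * X).
  by rewrite -set_valE; exact: initial_continuous.
have gK : involutive g.
  by case=> -[x y] Sxy; exact: val_inj.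
have cg : continuous g.
  apply: continuous_comp_initial => z; rewrite set_valE.
  apply: (@continuous_comp _ _ _ _ swap_pair z (cval z)).
  exact: swap_continuous.
have fiber x y : (forall z, S (x, z) -> z = y) ->
    forall z : set_type S, (\val z).1 = x -> (\val z).2 = y.
  move=> Sx z zx; apply: Sx; rewrite -zx -surjective_pairing.
  exact: set_valP.
exists (set_type S), (fst \o \val), g; split.
- exact: compact_hausdorff_set_type.
- split.
    by move=> z; apply: continuous_comp; [exact: cval|exact: cvg_fst].
  by move=> x _; have [y Sxy] := Stot x; exists (SigSub (mem_set Sxy)).
- by split=> //; exists g.
- apply/seteqP; split=> [_ [z /= za <-]|z /= zb].
    exact: (fiber a b).
  by exists (g z); [exact: (fiber b a)|exact: gK].
Qed.

Theorem theorem5p7 (X : topologicalType)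
    (hX : compact_hausdorff X)
    (hfc : first_countable X)
    (hcr : crowded X) :
  pin_homogeneous X.
Proof.
move=> a b; have [<-|ab] := pselect (a = b); first exact: pin_equivalent_refl.
have [G [H [aG bH GH]]] := hausdorff_sep hX.1 ab.
have [ O [EO Oa]] := exists_shrinks_to hX.1 hfc hcr aG.
have [P [EP Pb]] := exists_shrinks_to hX.1 hfc hcr bH.
pose L := level_rel (~` H) (~` G) O P.
pose S : set (X * X) := L `|` swap_pair @^-1` L.
have cL : closed L.
  apply: closed_level_rel.
  - exact: open_closedC bH.1.
  - exact: open_closedC aG.1.
  - by move=> n; case: Oa => /(_ n)[].
  - by move=> n; case: Pb => /(_ n)[].
apply: (@pin_equivalent_symmetric_rel _ S) => //.
- apply: closedU => //.
  have /continuous_closedP : continuous (@swap_pair X X) := swap_continuous.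
  by apply.
- by move=> x y [xy|xy]; [right|left].
(* Disjointness of [G] and [H] makes their complements cover [X]: a point of [H] finds its partner
   through the transpose of [L], any other point through [L] itself. *)
- move=> x; have [Hx|nHx] := pselect (H x).
    have nGx : (~` G) x by move=> /GH.
    have GnH : O 0 `<=` ~` H by rewrite EO.
    have [y xy] := level_rel_total Pb Oa GnH nGx.
    by exists y; right; exact: level_rel_swap xy.
  have HnG : P 0 `<=` ~` G by rewrite EP => z Hz /GH.
  have [y xy] := level_rel_total (A := ~` H) Oa Pb HnG nHx.
  by exists y; left.
(* A pair starting at [a] cannot come from the transpose, which would put [a] outside [G]; likewise
   a pair starting at [b] cannot lie in [L]. *)
- move=> y [|[]]; first exact: level_rel_center.
  by move=> _ /(_ aG.2).
- move=> y [[/(_ bH.2)//]|/level_rel_swap]; exact: level_rel_center.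
Qed.
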